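(* Let $(\mathfrak n,g)$ be an irreducible $2$-step nilpotent metric Lie algebra. Then there is a one-to-one correspondence between non-zero Killing $2$-forms on $(\mathfrak n,g)$, up to multiplication with a positive real number, and orthogonal bi-invariant complex structures on $(\mathfrak n,g)$.
   Context: A real finite-dimensional Lie algebra $\mathfrak n$ is $2$-step nilpotent if it is non-abelian and $[\mathfrak n,\mathfrak n]$ is contained in its center. A metric Lie algebra $(\mathfrak n,g)$ is a Lie algebra with an inner product; it is reducible if it is an orthogonal direct sum of two non-zero ideals, and irreducible otherwise. Let $N$ be the simply connected Lie group with Lie algebra $\mathfrak n$, with the left-invariant Riemannian metric induced by $g$ and Levi-Civita connection $\nabla$. Left-invariant $k$-forms on $N$ are identified with elements of $\Lambda^k\mathfrak n^*$. A Killing $k$-form on $(\mathfrak n,g)$ is an $\alpha\in\Lambda^k\mathfrak n^*$ whose associated left-invariant form on $N$ is Killing, i.e. $\nabla_y\alpha=\frac1{k+1}\,y\lrcorner\, d\alpha$ for all $y\in\mathfrak n$ ($\lrcorner$ denotes contraction, $d$ the Lie algebra differential). A bi-invariant complex structure on $\mathfrak n$ is an endomorphism $J$ of $\mathfrak n$ with $J^2=-\mathrm{Id}$ and $J[x,y]=[Jx,y]$ for all $x,y\in\mathfrak n$; it is orthogonal if $g(Jx,Jy)=g(x,y)$ for all $x,y\in\mathfrak n$. *)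

(* Defs.v *)
From HB Require Import structures.
From mathcomp Require Import all_boot all_order all_algebra.
From mathcomp Require Import boolp classical_sets functions reals.
From mathcomp Require Import ring lra.

Set Implicit Arguments.
Unset Strict Implicit.
Unset Printing Implicit Defensive.

Import Order.TTheory GRing.Theory Num.Theory.
Local Open Scope classical_set_scope.
Local Open Scope ring_scope.

Section MetricLieAlgebra.
Variables (R : realType) (n : vectType R).
Variables (br : {bilinear n -> n -> n}) (g : {dot n for idfun}).

Definition is_lie_bracket : Prop :=
  (forall x, br x x = 0) /\
  (forall x y z, br x (br y z) + br y (br z x) + br z (br x y) = 0).

Definition central (z : n) : Prop := forall x, br z x = 0.

(* The center is a subspace, so it contains [n, n] as soon as it contains
   every bracket. *)
Definition two_step_nilpotent : Prop :=
  (exists x y, br x y != 0) /\ (forall x y, central (br x y)).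

Definition ideal (a : {vspace n}) : Prop :=
  forall x y, y \in a -> br x y \in a.

(* The sum of a and b is direct because they are orthogonal and g is definite. *)
Definition reducible : Prop :=
  exists a b : {vspace n},
    [/\ ideal a, ideal b, a != 0%VS & b != 0%VS] /\
    ((a + b)%VS = fullv /\
     forall x y, x \in a -> y \in b -> g x y = 0).

(* Restriction to left-invariant fields of the Levi-Civita connection:
   functions g(y, z) of left-invariant y and z are constant, so compatibility
   with the metric has no derivative term. *)
Definition is_levi_civita (nabla : {bilinear n -> n -> n}) : Prop :=
  (forall x y, nabla x y - nabla y x = br x y) /\
  (forall x y z, g (nabla x y) z + g y (nabla x z) = 0).

Lemma dot_inj u v : (forall z, g u z = g v z) -> u = v.
Proof.
move=> e; apply/eqP; rewrite -subr_eq0; apply/negPn/negP => uv0.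
have : 0 < g (u - v) (u - v) by apply: neq0_dnorm_gt0.
by rewrite linearBl /= e subrr ltxx.
Qed.

Lemma riesz (f : {linear n -> R^o}) : exists w, forall z, g w z = f z.
Proof.
pose G0 (x : n) : 'Hom(n, R^o) := linfun (g x : n -> R^o).
have GE x z : G0 x z = g x z.
  have gl : linear (g x : n -> R^o) by move=> c u v; rewrite linearDr linearZr.
  pose h := GRing.isLinear.Build _ _ _ _ (g x : n -> R^o) gl.
  pose H : {linear n -> R^o} := HB.pack (g x : n -> R^o) h.
  by rewrite /G0 -[g x]/(H : n -> R^o) lfunE.
have Gl : linear G0.
  move=> c u v; apply/lfunP => z.
  by rewrite add_lfunE scale_lfunE !GE linearDl linearZl.
pose h := GRing.isLinear.Build _ _ _ _ G0 Gl.
pose G : {linear n -> 'Hom(n, R^o)} := HB.pack G0 h.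
have k0 : lker (linfun G) == 0%VS.
  apply/lker0P => x y; rewrite !lfunE /= => /lfunP e.
  by apply: dot_inj => z; rewrite -!GE.
have full : limg (linfun G) = fullv.
  apply/eqP; rewrite eqEdim subvf /= limg_dim_eq ?(eqP k0) ?capv0//.
  by rewrite !dimvf /dim /= muln1.
have : linfun f \in limg (linfun G) by rewrite full memvf.
move=> /memv_imgP[w _ e]; exists w => z.
by rewrite -(lfunE f) e lfunE /= GE.
Qed.

Lemma levi_civita_unique (nabla1 nabla2 : {bilinear n -> n -> n}) :
  is_levi_civita nabla1 -> is_levi_civita nabla2 ->
  forall x y, nabla1 x y = nabla2 x y.
Proof.
have koszul (nabla : {bilinear n -> n -> n}) : is_levi_civita nabla ->
    forall x y z,
    g (nabla x y) z *+ 2 = g (br x y) z - g (br y z) x + g (br z x) y.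
  case=> tor met x y z; rewrite -!tor !linearBl.
  have gC u v : g u v = g v u by rewrite hermC /= expr0 mul1r.
  move: (met x y z) (met y z x) (met z x y).
  rewrite (gC y) (gC z (nabla y x)) (gC x (nabla z y)); lra.
move=> h1 h2 x y; apply: dot_inj => z.
by have := koszul _ h1 x y z; rewrite -(koszul _ h2); lra.
Qed.

Lemma levi_civita_exists : is_lie_bracket ->
  exists nabla : {bilinear n -> n -> n}, is_levi_civita nabla.
Proof.
case=> alt _.
have gC u v : g u v = g v u by rewrite hermC /= expr0 mul1r.
have brC x y : br x y = - br y x.
  have := alt (x + y); rewrite linearDl !linearDr !alt add0r addr0.
  by move/eqP; rewrite addr_eq0 => /eqP.
have ex (p : n * n) : exists w, forall z, g w z = 2^-1 *
    (g (br p.1 p.2) z - g (br p.2 z) p.1 + g (br z p.1) p.2).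
  case: p => x y /=.
  pose k z : R^o := 2^-1 * (g (br x y) z - g (br y z) x + g (br z x) y).
  have kl : linear k.
    move=> c u v; rewrite /k !(linearDr, linearZr, linearDl, linearZl) /=.
    by rewrite /GRing.scale /=; ring.
  pose h := GRing.isLinear.Build _ _ _ _ k kl.
  exact: (riesz (HB.pack k h : {linear n -> R^o})).
have [w wE] := choice ex.
pose nab x y := w (x, y).
have nabE x y z : g (nab x y) z = 2^-1 *
    (g (br x y) z - g (br y z) x + g (br z x) y) by exact: wE.
have bl : bilinear_for *:%R *:%R nab.
  split=> [y|x] c u v; apply: dot_inj => z; rewrite linearDl linearZl /= !nabE.
    by rewrite !(linearDr, linearZr, linearDl, linearZl) /=; ring.
  by rewrite !(linearDr, linearZr, linearDl, linearZl) /=; ring.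
pose h := bilinear_isBilinear.Build _ _ _ _ _ _ nab bl.
pose nabla : {bilinear n -> n -> n} := HB.pack nab h.
exists nabla; split=> [x y|x y z].
  apply: dot_inj => z; rewrite linearBl /= !nabE.
  rewrite (brC y x) (brC z x) (brC y z) !linearNl /=; lra.
rewrite (gC y) /= !nabE (brC z y) (brC x z) (brC y x) !linearNl /=; lra.
Qed.

(* Elements of the second exterior power of the dual of n are the terms of
   {skew_symmetric n}. *)
Definition cov_deriv (nabla : {bilinear n -> n -> n})
    (alpha : {skew_symmetric n}) (y u v : n) : R :=
  - alpha (nabla y u) v - alpha u (nabla y v).

(* Chevalley-Eilenberg differential, normalised without a factor 1/3. *)
Definition lie_diff (alpha : {skew_symmetric n}) (x y z : n) : R :=
  - alpha (br x y) z + alpha (br x z) y - alpha (br y z) x.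

(* The factor 3^-1 is 1 / (k + 1) for k = 2; the contraction of y with
   d alpha fills its first argument. *)
Definition killing_2form (nabla : {bilinear n -> n -> n})
    (alpha : {skew_symmetric n}) : Prop :=
  forall y u v : n,
    cov_deriv nabla alpha y u v = 3^-1 * lie_diff alpha y u v.

Definition pos_ray (alpha : {skew_symmetric n}) : set {skew_symmetric n} :=
  [set beta | exists2 c : R, 0 < c & forall x y, beta x y = c * alpha x y].

(* The non-zero Killing 2-forms modulo multiplication by positive reals. *)
Definition killing_rays (nabla : {bilinear n -> n -> n}) :
    set (set {skew_symmetric n}) :=
  [set pos_ray alpha | alpha in
    [set alpha : {skew_symmetric n} |
      killing_2form nabla alpha /\ exists x y, alpha x y != 0]].

Definition orthogonal_biinvariant_complex_structures : set 'End(n) :=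
  [set J : 'End(n) |
    [/\ forall x, J (J x) = - x,
        forall x y, J (br x y) = br (J x) y
      & forall x y, g (J x) (J y) = g x y]].

End MetricLieAlgebra.

(* Main.v *)
Require Import Defs.
From HB Require Import structures.
From mathcomp Require Import all_boot all_order all_algebra.
From mathcomp Require Import boolp classical_sets functions reals.
From mathcomp Require Import complex ring lra.

Set Implicit Arguments.
Unset Strict Implicit.
Unset Printing Implicit Defensive.

Import Order.TTheory GRing.Theory Num.Theory.
Local Open Scope classical_set_scope.
Local Open Scope ring_scope.
Import passmx.

(** Write a 2-form as alpha(x, y) = g(A x, y) with A skew.  Substituting the
    Koszul formula turns the Killing equation into the algebraic condition
    A [x, y] = 3 [x, A y] ([killing_equivariant]).

    Let P be the orthogonal projection onto the center.  The condition forces A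
    to preserve the center, hence to commute with P, and brackets are central,
    so dividing A by 3 on the center and leaving it alone on the orthogonal
    complement of the center absorbs the factor 3: the endomorphism
    B = A (1 - 2/3 P) is skew and satisfies B [x, y] = [x, B y].  Conversely
    A = B (1 + 2 P), so Killing 2-forms are the same thing as skew
    endomorphisms that commute with every ad x.

    The square S of such a B is symmetric and also commutes with every ad x.
    For each real a, the kernel and the image of S - a are then orthogonal
    complementary ideals; taking for a an eigenvalue of S, irreducibility
    leaves only S = a ([symmetric_equivariant_scalar]).  When B is non-zero,
    skewness gives a = - c^2 with c > 0, and J = B / c is an orthogonal
    bi-invariant complex structure.  The positive number c is the only freedom,
    because c J and J are both complex structures only if c = 1; so J depends
    only on the ray of alpha and determines it ([associated_inj]). *)

(** * Symmetric and skew endomorphisms of a Euclidean space *)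

Section EuclideanSpace.
Variables (R : realType) (n : vectType R) (g : {dot n for idfun}).

Lemma dotC u v : g u v = g v u.
Proof. by rewrite hermC /= expr0 mul1r. Qed.

Lemma dot_ge0 u : 0 <= g u u.
Proof.
have [->|u0] := eqVneq u 0; first by rewrite linear0l.
exact/ltW/neq0_dnorm_gt0.
Qed.

Lemma dot_eq0 u : g u u = 0 -> u = 0.
Proof.
move=> u0; apply/eqP/negPn/negP => /(@neq0_dnorm_gt0 _ _ _ g).
by rewrite u0 ltxx.
Qed.

(** Riesz representation with a parameter: it provides both the endomorphism of
    a 2-form and adjoints of endomorphisms. *)
Lemma form_represented (b : n -> n -> R) :
  (forall y, scalar (b^~ y)) -> (forall x, scalar (b x)) ->
  exists A : 'End(n), forall x y, g (A x) y = b x y.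
Proof.
move=> bl br.
have ex x : exists w, forall y, g w y = b x y.
  pose k y : R^o := b x y.
  have kl : linear k by move=> c u v; rewrite /k br.
  pose h := GRing.isLinear.Build _ _ _ _ k kl.
  exact: (@riesz _ _ g (HB.pack k h : {linear n -> R^o})).
have [w wE] := choice ex.
have wl : linear w.
  move=> c u v; apply: (@dot_inj _ _ g) => z.
  by rewrite linearDl linearZl /= !wE bl.
pose h := GRing.isLinear.Build _ _ _ _ w wl.
exists (linfun (HB.pack w h : {linear n -> n})) => x y.
by rewrite lfunE wE.
Qed.

Definition symmetric_endo (S : 'End(n)) := forall x y, g (S x) y = g x (S y).
Definition skew_endo (A : 'End(n)) := forall x y, g (A x) y = - g x (A y).

(** g (S u) x = g u (S x) vanishes for x in the kernel; the dimension formula then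
    makes the orthogonal sum of kernel and image the whole space. *)
Lemma symmetric_ker_img S : symmetric_endo S ->
  [/\ (lker S :&: limg S)%VS = 0%VS, (lker S + limg S)%VS = fullv &
     forall x y, x \in lker S -> y \in limg S -> g x y = 0].
Proof.
move=> sS.
have orth x y : x \in lker S -> y \in limg S -> g x y = 0.
  rewrite memv_ker => /eqP Sx /memv_imgP[u _ ->].
  by rewrite -sS Sx linear0l.
have cap0 : (lker S :&: limg S)%VS = 0%VS.
  apply/eqP; rewrite -subv0; apply/subvP => x; rewrite memv_cap => /andP[xk xi].
  by rewrite memv0; apply/eqP/dot_eq0/orth.
split=> //; apply/eqP; rewrite eqEdim subvf /=.
by rewrite dimv_disjoint_sum // -(limg_ker_dim S fullv) capfv.
Qed.

Lemma symmetric_eigenvector (S : 'End(n)) (x0 : n) : x0 != 0 ->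
  symmetric_endo S -> exists a x, x != 0 /\ S x = a *: x.
Proof.
move=> x00 sS.
pose e := vbasis {:n}; have eb : basis_of {:n} e := vbasisP _.
pose M := mxof e e S.
have ME u : vecof e (u *m M) = S (vecof e u) by rewrite (hom_vecof e eb).
have d0 : (0 < \dim {:n})%N.
  by rewrite lt0n dimv_eq0; apply: contra x00 => /eqP f0; rewrite -memv0 -f0 memvf.
(* The real and imaginary parts p, q of an eigenvector of the complexified
   matrix span an S-stable plane, on which symmetry kills the imaginary part of
   the eigenvalue. *)
have [w /eigenvalueP[v vM v0]] : exists w, eigenvalue (map_mx (real_complex R) M) w.
  have /closed_rootP [a rAa] :
      size (char_poly (map_mx (real_complex R) M)) != 1%N.
    by rewrite size_char_poly; move: d0; case: (\dim _) M {ME}.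
  by exists a; rewrite eigenvalue_root_char.
case: w vM => a b vM.
pose p := vecof e (map_mx (@complex.Re R) v).
pose q := vecof e (map_mx (@complex.Im R) v).
have Sp : S p = a *: p - b *: q.
  rewrite -ME -!linearZ -linearB /=; congr vecof; apply/rowP => j.
  have /(congr1 (@complex.Re R)) := congr1 (fun u : 'rV_ _ => u 0 j) vM.
  rewrite !mxE /= => vj; transitivity (complex.Re ((a +i* b)%C * v 0 j)).
    rewrite -vj raddf_sum; apply: eq_bigr => i _; rewrite !mxE.
    by case: (v 0 i) => r s /=; ring.
  by case: (v 0 j) => r s.
have Sq : S q = b *: p + a *: q.
  rewrite -ME -!linearZ -linearD /=; congr vecof; apply/rowP => j.
  have /(congr1 (@complex.Im R)) := congr1 (fun u : 'rV_ _ => u 0 j) vM.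
  rewrite !mxE /= => vj; transitivity (complex.Im ((a +i* b)%C * v 0 j)).
    rewrite -vj raddf_sum; apply: eq_bigr => i _; rewrite !mxE.
    by case: (v 0 i) => r s /=; ring.
  by case: (v 0 j) => r s /=; ring.
have pq0 : (p != 0) || (q != 0).
  rewrite -negb_and; apply: contra v0 => /andP[/eqP p0 /eqP q0].
  apply/eqP/rowP => j; rewrite mxE.
  have := congr1 (coord e j) p0; have := congr1 (coord e j) q0.
  by rewrite !coord_vecof // !linear0 !mxE; case: (v 0 j) => r s /= -> ->.
have b0 : b = 0.
  have pos : 0 < g p p + g q q.
    have := dot_ge0 p; have := dot_ge0 q.
    by case/orP: pq0 => /(@neq0_dnorm_gt0 _ _ _ g); lra.
  have := sS p q; rewrite Sp Sq linearBl linearDr !linearZl !linearZr /= => sym.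
  have : b * (g p p + g q q) = 0 by lra.
  by move/eqP; rewrite mulf_eq0 (gt_eqF pos) orbF => /eqP.
rewrite b0 scale0r subr0 in Sp; rewrite b0 scale0r add0r in Sq.
by case/orP: pq0 => nz; exists a; [exists p | exists q].
Qed.

Lemma orthogonal_projection (C : {vspace n}) : exists P : 'End(n),
  [/\ symmetric_endo P, forall x, P x \in C & forall x, x \in C -> P x = x].
Proof.
have [Q QE] : exists Q : 'End(n), forall x y, g (Q x) y = g x (projv C y).
  by apply: form_represented => [y|x] c u v;
    rewrite ?linearDl ?linearZl // linearP linearDr linearZr.
(* Q is the adjoint of some projection onto C, so S is symmetric with image
   inside C and kernel orthogonal to C: projecting onto the image of S along its
   kernel is the orthogonal projection onto C. *)
pose S := (projv C \o Q)%VF.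
have SE x y : g (S x) y = g (Q x) (Q y).
  by rewrite comp_lfunE dotC -QE dotC.
have sS : symmetric_endo S by move=> x y; rewrite SE dotC -SE dotC.
have [cap0 full orth] := symmetric_ker_img sS.
have SC x : x \in limg S -> x \in C.
  by move=> /memv_imgP[u _ ->]; rewrite comp_lfunE memv_proj.
have kC x y : x \in lker S -> y \in C -> g x y = 0.
  rewrite memv_ker => /eqP Sx yC; have : g (S x) x = 0 by rewrite Sx linear0l.
  by rewrite SE => /dot_eq0 Qx; rewrite -(projv_id yC) -QE Qx linear0l.
pose P := daddv_pi (limg S) (lker S).
have cap0' : (limg S :&: lker S)%VS = 0%VS by rewrite capvC.
have PC x : P x \in C by apply: SC; apply: memv_pi.
have xE x : P x + daddv_pi (lker S) (limg S) x = x.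
  by apply: daddv_pi_add => //; rewrite addvC full memvf.
have QC x y : y \in C -> g (P x) y = g x y.
  move=> yC; rewrite -[in RHS](xE x) linearDl /=.
  by rewrite (kC (daddv_pi (lker S) (limg S) x)) ?addr0 ?memv_pi.
exists P; split=> // [x y|x xC].
  by rewrite [LHS]dotC -[LHS](QC _ _ (PC x)) dotC QC.
apply: (@dot_inj _ _ g) => z; apply/eqP; rewrite -subr_eq0 -linearBl; apply/eqP.
suff -> : P x - x = 0 by rewrite linear0l.
by apply: dot_eq0; rewrite linearBl /= QC ?subrr // rpredB.
Qed.

End EuclideanSpace.

(** * Endomorphisms commuting with the adjoint representation *)

Section TwoStepNilpotent.
Variables (R : realType) (n : vectType R).
Variables (br : {bilinear n -> n -> n}) (g : {dot n for idfun}).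
Hypothesis br_lie : is_lie_bracket br.

Definition bracket_equivariant (A : 'End(n)) :=
  forall x y, A (br x y) = br x (A y).

Lemma bracketC x y : br x y = - br y x.
Proof.
have alt := br_lie.1.
have := alt (x + y); rewrite linearDl !linearDr !alt add0r addr0.
by move/eqP; rewrite addr_eq0 => /eqP.
Qed.

Lemma central_bracketr z x : central br z -> br x z = 0.
Proof. by move=> zC; rewrite bracketC zC oppr0. Qed.

(** The center is the kernel of the adjoint representation. *)
Lemma center_subspace : exists C : {vspace n}, forall z, z \in C <-> central br z.
Proof.
pose ad0 x : 'End(n) := linfun (br x).
have adE x y : ad0 x y = br x y by rewrite lfunE.
have adl : linear ad0.
  move=> c u v; apply/lfunP => z.
  by rewrite add_lfunE scale_lfunE !adE linearDl linearZl.
pose h := GRing.isLinear.Build _ _ _ _ ad0 adl.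
pose ad : {linear n -> 'End(n)} := HB.pack ad0 h.
exists (lker (linfun ad)) => z; rewrite memv_ker lfunE /=; split.
  by move/eqP => z0 x; rewrite -adE z0 lfunE.
by move=> zC; apply/eqP/lfunP => x; rewrite adE zC lfunE.
Qed.

(** A Schur lemma for irreducible metric Lie algebras: with a an eigenvalue of S,
    the kernel and the image of S - a are orthogonal complementary ideals, and
    the kernel is non-zero. *)
Lemma symmetric_equivariant_scalar (S : 'End(n)) :
  ~ reducible br g -> symmetric_endo g S -> bracket_equivariant S ->
  exists a, forall x, S x = a *: x.
Proof.
move=> irr sS eS.
have [[x0 x00]|n0] := pselect (exists x : n, x != 0); last first.
  by exists 0 => x; rewrite scale0r; have [->|x0] := eqVneq x 0;
    [rewrite linear0 | case: n0; exists x].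
have [a [x [x_neq0 Sx]]] := symmetric_eigenvector x00 sS.
exists a.
pose T : 'End(n) := S - a *: \1%VF.
have TE y : T y = S y - a *: y by rewrite add_lfunE opp_lfunE scale_lfunE id_lfunE.
have sT : symmetric_endo g T.
  by move=> u v; rewrite !TE linearBl linearBr /= linearZl linearZr /= sS.
have eT : bracket_equivariant T.
  by move=> u v; rewrite !TE eS linearBr /= linearZr.
have [_ full orth] := symmetric_ker_img sT.
suff /eqP imT0 : limg T == 0%VS.
  move=> y; apply/eqP; rewrite -subr_eq0 -TE -memv0 -imT0.
  exact/memv_img/memvf.
apply: contrapT => /negP imT0; apply: irr; exists (lker T), (limg T); split; last first.
  by split.
split=> //.
- by move=> u v; rewrite !memv_ker eT => /eqP ->; rewrite linear0r.
- by move=> u v /memv_imgP[w _ ->]; rewrite -eT memv_img ?memvf.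
- apply: contra x_neq0 => /eqP k0.
  by rewrite -memv0 -k0 memv_ker TE Sx subrr.
Qed.

(** The square is a scalar a by the Schur lemma, and a |x|^2 = - |B x|^2 makes a
    negative. *)
Lemma skew_equivariant_square (B : 'End(n)) :
  ~ reducible br g -> skew_endo g B -> bracket_equivariant B ->
  (exists x, B x != 0) ->
  exists2 c, 0 < c & forall x, B (B x) = - (c ^+ 2 *: x).
Proof.
move=> irr kB eB [x Bx0].
have [a BB] : exists a, forall x, (B \o B)%VF x = a *: x.
  apply: symmetric_equivariant_scalar => // u v; rewrite !comp_lfunE.
    by rewrite !kB opprK.
  by rewrite !eB.
have BBE y : B (B y) = a *: y by rewrite -BB comp_lfunE.
have a0 : a < 0.
  have x0 : x != 0 by apply: contra Bx0 => /eqP ->; rewrite linear0.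
  have := kB (B x) x; rewrite BBE linearZl /=.
  have := @neq0_dnorm_gt0 _ _ _ g _ x0; have := @neq0_dnorm_gt0 _ _ _ g _ Bx0.
  by nra.
exists (Num.sqrt (- a)); first by rewrite sqrtr_gt0 oppr_gt0.
by move=> y; rewrite BBE sqr_sqrtr ?oppr_ge0 ?ltW // scaleNr opprK.
Qed.

(** * The Killing equation as an algebraic condition *)

Section Killing.
Variable nabla : {bilinear n -> n -> n}.
Hypothesis nabla_lc : is_levi_civita br g nabla.

Lemma koszul x y z :
  g (nabla x y) z *+ 2 = g (br x y) z - g (br y z) x + g (br z x) y.
Proof.
case: nabla_lc => tor met; rewrite -!tor !linearBl.
move: (met x y z) (met y z x) (met z x y).
rewrite (dotC g y) (dotC g z (nabla y x)) (dotC g x (nabla z y)); lra.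
Qed.

(** All covariant derivatives reduce to brackets by [koszul].  For the direct
    implication, the Killing equation at (y, u, v) is used twice: with y and u
    central it shows that A preserves the center; with only u central it gives the
    condition paired with u, which suffices because both of its sides are
    central. *)
Lemma killing_equivariant (alpha : {skew_symmetric n}) (A : 'End(n)) :
  two_step_nilpotent br ->
  skew_endo g A -> (forall x y, g (A x) y = alpha x y) ->
  killing_2form br nabla alpha <->
  forall x y, A (br x y) = 3 *: br x (A y).
Proof.
move=> [_ nil] kA AE; split=> [K x w|eA y u v]; last first.
  have e p q r : g (br p (A q)) r = 3^-1 * g (A (br p q)) r.
    by rewrite eA linearZl /=; lra.
  have e' p q r : g (br (A q) p) r = - (3^-1 * g (A (br p q)) r).
    by rewrite bracketC linearNl /= e.
  have flip p q : g p (A q) = - g q (A p) by rewrite dotC kA.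
  have anti : g (A (br v u)) y = - g (A (br u v)) y.
    by rewrite bracketC linearN linearNl.
  have := koszul y u (A v); have := koszul y v (A u).
  rewrite /cov_deriv /lie_diff -!AE !e !e' anti !kA (flip u).
  by lra.
have flip p q : g p (A q) = - g q (A p) by rewrite dotC kA.
have AC z : central br z -> central br (A z).
  (* For central z', the Killing equation gives g (A z) (nabla z' t) = 0, and the
     Koszul formula rewrites this as g [t, A z] z' = 0; z' = [t, A z] is
     central. *)
  move=> zC t; rewrite bracketC; apply/eqP; rewrite oppr_eq0; apply/eqP.
  apply: (@dot_eq0 _ _ g); set z' := {2}(br t (A z)).
  have z'C : central br z' by apply: nil.
  have nab0 : nabla z' z = 0.
    apply: (@dot_eq0 _ _ g); have := koszul z' z (nabla z' z).
    by rewrite zC z'C (central_bracketr _ z'C) !linear0l; lra.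
  have := K z' z t; rewrite /cov_deriv /lie_diff -!AE nab0 !zC !z'C.
  have := koszul z' t (A z).
  by rewrite z'C (central_bracketr _ z'C) !(linear0, linear0l) (dotC _ (A z)); lra.
have centralP z : central br z -> g (A (br x w)) z = g (3 *: br x (A w)) z.
  move=> zC; have := K x z w; rewrite /cov_deriv /lie_diff -!AE.
  rewrite zC (central_bracketr _ zC) linear0 !linear0l linearZl /=.
  have := koszul x w (A z); have := koszul x z (A w).
  rewrite zC (central_bracketr _ zC) (central_bracketr _ (AC _ zC)) (AC _ zC).
  by rewrite !linear0l (bracketC (A w)) linearNl !kA (flip z); lra.
apply/eqP; rewrite -subr_eq0; apply/eqP/(@dot_eq0 _ _ g).
rewrite linearBl /= centralP ?subrr // => t.
by rewrite linearBl linearZl /= nil AC ?nil // scaler0 subrr.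
Qed.
End Killing.

Lemma skew_form_of_endo (A : 'End(n)) : skew_endo g A ->
  exists alpha : {skew_symmetric n}, forall x y, alpha x y = g (A x) y.
Proof.
move=> kA; pose b x y := g (A x) y.
have bl c u v y : b (c *: u + v) y = c * b u y + b v y.
  by rewrite /b linearP linearDl linearZl.
have br_lin x c u v : b x (c *: u + v) = c * b x u + b x v.
  by rewrite /b linearDr linearZr.
have bh u v : b u v = (-1) ^+ true * idfun (b v u).
  by rewrite /b /= expr1 mulN1r kA dotC.
pose h1 := isBilinear.Build R n n R *%R (idfun \; *%R) b
  (fun y => zmod_morphism_linear (fun c u v => bl c u v y))
  (fun x => zmod_morphism_linear (br_lin x))
  (fun y => scalable_linear (fun c u v => bl c u v y))
  (fun x => scalable_linear (br_lin x)).
pose h2 := isHermitianSesquilinear.Build R n true idfun b bh.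
by exists (HB.pack b h1 h2 : {skew_symmetric n}).
Qed.

(** * From Killing forms to complex structures and back *)

Section Correspondence.
Variable P : 'End(n).
Hypothesis P_symmetric : symmetric_endo g P.
Hypothesis P_central : forall x, central br (P x).
Hypothesis P_id : forall x, central br x -> P x = x.

Local Notation OBC := (orthogonal_biinvariant_complex_structures br g).

(** Multiplication by 1 + s on the center and by 1 on its orthogonal
    complement. *)
Definition reweight (s : R) : 'End(n) := \1%VF + s *: P.

Lemma reweightE s x : reweight s x = x + s *: P x.
Proof. by rewrite add_lfunE scale_lfunE id_lfunE. Qed.

(** The hypothesis says that 1 + s and 1 + t are inverse to each other. *)
Lemma reweightK s t x : s + t + s * t = 0 -> reweight t (reweight s x) = x.
Proof.
move=> st0; rewrite !reweightE [P (x + _)]linearD /= [P (s *: _)]linearZ /=.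
rewrite (P_id (P_central x)) -[in X in _ + t *: (X + _)](scale1r (P x)) -scalerDl.
rewrite scalerA -addrA -scalerDl.
suff -> : s + t * (1 + s) = 0 by rewrite scale0r addr0.
by rewrite -st0; ring.
Qed.

Lemma reweight_central s x : central br x -> reweight s x = (1 + s) *: x.
Proof. by move=> xC; rewrite reweightE P_id // scalerDl scale1r. Qed.

Lemma projection_comm (A : 'End(n)) :
  skew_endo g A -> (forall x, central br x -> central br (A x)) ->
  forall x, A (P x) = P (A x).
Proof.
move=> kA AC x; apply: (@dot_inj _ _ g) => z.
have APc y := P_id (AC _ (P_central y)).
by rewrite -APc P_symmetric kA P_symmetric APc -kA P_symmetric.
Qed.

(** A commutes with the symmetric endomorphism [reweight s], because a skew
    endomorphism that preserves the center also preserves its orthogonal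
    complement. *)
Lemma skew_reweight (A : 'End(n)) s :
  skew_endo g A -> (forall x, central br x -> central br (A x)) ->
  skew_endo g (A \o reweight s)%VF.
Proof.
move=> kA AC x y; rewrite !comp_lfunE !reweightE kA linearDl linearZl /=.
rewrite P_symmetric -(projection_comm kA AC).
by rewrite -linearZr -linearDr -linearZ -linearD.
Qed.

Lemma bracket_reweight (A : 'End(n)) s x y :
  (forall x, central br x -> central br (A x)) ->
  br x (A (reweight s y)) = br x (A y).
Proof.
move=> AC; rewrite reweightE linearD linearZ linearDr linearZr /=.
by rewrite (central_bracketr _ (AC _ (P_central y))) scaler0 addr0.
Qed.

Lemma equivariant_center (A : 'End(n)) : bracket_equivariant A ->
  forall x, central br x -> central br (A x).
Proof.
by move=> eA x xC y; rewrite bracketC -eA (central_bracketr _ xC) linear0 oppr0.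
Qed.

(** The weight 3 = 1 + 2 on the center is the factor 3 of the Killing
    condition. *)
Definition associated (J : 'End(n)) (alpha : {skew_symmetric n}) :=
  exists2 c, 0 < c & forall x y, alpha x y = c * g (J (reweight 2 x)) y.

Lemma associated_exists (nabla : {bilinear n -> n -> n}) (J : 'End(n)) :
  two_step_nilpotent br -> is_levi_civita br g nabla -> OBC J ->
  exists alpha, [/\ associated J alpha, killing_2form br nabla alpha &
    exists x y, alpha x y != 0].
Proof.
move=> nil lc [JJ Jbr Jg].
have kJ : skew_endo g J by move=> x y; rewrite -[in RHS]Jg JJ linearNr opprK.
have eJ : bracket_equivariant J.
  by move=> x y; rewrite bracketC linearN /= Jbr -bracketC.
have JC := equivariant_center eJ.
have kA := skew_reweight 2 kJ JC.
have [alpha alphaE] := skew_form_of_endo kA.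
have alphaE' x y : alpha x y = g (J (reweight 2 x)) y by rewrite alphaE comp_lfunE.
exists alpha; split.
- by exists 1 => // x y; rewrite mul1r.
- apply/(killing_equivariant lc nil kA) => // x y.
  rewrite !comp_lfunE bracket_reweight // (reweight_central _ (nil.2 _ _)).
  by rewrite linearZ /= eJ; congr (_ *: _); lra.
(* Undoing the weight in the first argument leaves g (J x) (J x). *)
case: (nil) => -[x [y xy0]] _; exists (reweight (- (2 / 3)) x), (J x).
have x0 : x != 0 by apply: contra xy0 => /eqP ->; rewrite linear0l.
rewrite alphaE' reweightK; last by lra.
by rewrite Jg gt_eqF // neq0_dnorm_gt0.
Qed.

Lemma associated_killing (nabla : {bilinear n -> n -> n})
    (alpha : {skew_symmetric n}) :
  two_step_nilpotent br -> ~ reducible br g -> is_levi_civita br g nabla ->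
  killing_2form br nabla alpha -> (exists x y, alpha x y != 0) ->
  exists2 J, OBC J & associated J alpha.
Proof.
move=> nil irr lc K alpha0.
have [A AE] : exists A : 'End(n), forall x y, g (A x) y = alpha x y.
  by apply: form_represented => [y|x] c u v;
    rewrite ?linearDl ?linearZl // linearDr linearZr.
have kA : skew_endo g A.
  by move=> x y; rewrite AE [in RHS]dotC AE hermC /= expr1 mulN1r.
have eA := (killing_equivariant lc nil kA AE).1 K.
have AC x : central br x -> central br (A x).
  move=> xC y; rewrite bracketC; apply/eqP; rewrite oppr_eq0.
  have := eA y x; rewrite (central_bracketr _ xC) linear0 => /esym/eqP.
  by rewrite scaler_eq0 pnatr_eq0.
pose B := (A \o reweight (- (2 / 3)))%VF.
have BE x : B x = A (reweight (- (2 / 3)) x) by rewrite comp_lfunE.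
have ABE x : A x = B (reweight 2 x) by rewrite BE reweightK //; lra.
have kB : skew_endo g B by exact: skew_reweight.
have eB : bracket_equivariant B.
  move=> x y; rewrite !BE bracket_reweight // (reweight_central _ (nil.2 _ _)).
  by rewrite linearZ /= eA scalerA -[RHS]scale1r; congr (_ *: _); lra.
have B0 : exists x, B x != 0.
  case: alpha0 => x [y]; rewrite -AE ABE => nz; exists (reweight 2 x).
  by apply: contra nz => /eqP ->; rewrite linear0l.
have [c c0 BB] := skew_equivariant_square irr kB eB B0.
have c_neq0 : c != 0 by rewrite gt_eqF.
have JE x : (c^-1 *: B) x = c^-1 *: B x by rewrite scale_lfunE.
have JJ x : (c^-1 *: B) ((c^-1 *: B) x) = - x.
  rewrite !JE linearZ /= BB !scalerN !scalerA; congr (- _).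
  by rewrite -[RHS]scale1r; congr (_ *: _); field.
exists (c^-1 *: B).
  split=> // x y.
    by rewrite !JE linearZl /= [br (B x) y]bracketC -eB -linearN -bracketC.
  have kJ u v : g ((c^-1 *: B) u) v = - g u ((c^-1 *: B) v).
    by rewrite !JE linearZl linearZr /= kB mulrN.
  by rewrite kJ JJ linearNr opprK.
exists c => // x y.
by rewrite -AE ABE JE linearZl /= mulrA divff // mul1r.
Qed.

(** Two complex structures that differ by a positive factor k are equal, because
    comparing squares gives k ^+ 2 = 1. *)
Lemma associated_inj (J J' : 'End(n)) (alpha alpha' : {skew_symmetric n}) c :
  OBC J -> OBC J' -> (exists x : n, x != 0) ->
  0 < c -> (forall x y, alpha' x y = c * alpha x y) ->
  associated J alpha -> associated J' alpha' -> J = J'.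
Proof.
move=> [JJ _ _] [JJ' _ _] [x x0] c0 ca [d d0 dE] [d' d'0 d'E].
pose k := c * d / d'.
have d'_neq0 : d' != 0 by rewrite gt_eqF.
have k0 : 0 < k by rewrite !mulr_gt0 ?invr_gt0.
have J'E y : J' y = k *: J y.
  apply: (@dot_inj _ _ g) => z; rewrite linearZl /=.
  have := d'E (reweight (- (2 / 3)) y) z; rewrite ca dE reweightK; last by lra.
  by rewrite /k => e; apply: (mulfI d'_neq0); rewrite -e; field.
suff k1 : k = 1 by apply/lfunP => y; rewrite J'E k1 scale1r.
have : k ^+ 2 *: x = 1 *: x.
  have := JJ' x; rewrite !J'E linearZ /= JJ !scalerN => /oppr_inj.
  by rewrite scalerA scale1r.
move/eqP; rewrite -subr_eq0 -scalerBl scaler_eq0 (negPf x0) orbF subr_eq0.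
by rewrite sqrf_eq1 => /orP[/eqP //|/eqP k1]; move: k0; rewrite k1; lra.
Qed.

End Correspondence.

End TwoStepNilpotent.

(** * The bijection *)

Lemma pos_ray_eq (R : realType) (n : vectType R) (alpha beta : {skew_symmetric n}) c :
  0 < c -> (forall x y, beta x y = c * alpha x y) -> pos_ray alpha = pos_ray beta.
Proof.
move=> c0 e; have c_neq0 : c != 0 by rewrite gt_eqF.
apply/seteqP; split=> gamma [d d0 dE].
  exists (d / c) => [|x y]; first by rewrite divr_gt0.
  by rewrite dE e; field.
by exists (d * c) => [|x y]; [rewrite mulr_gt0 | rewrite dE e mulrA].
Qed.

Theorem proposition4p7 (R : realType) (n : vectType R)
  (br : {bilinear n -> n -> n}) (g : {dot n for idfun})
  (nabla : {bilinear n -> n -> n})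
  (hLie : is_lie_bracket br)
  (hnil : two_step_nilpotent br)
  (hirr : ~ reducible br g)
  (hnabla : is_levi_civita br g nabla) :
  exists F : set {skew_symmetric n} -> 'End(n),
    set_bij (killing_rays br nabla)
            (orthogonal_biinvariant_complex_structures br g) F.
Proof.
have n0 : exists x : n, x != 0.
  by case: hnil => -[x [y xy0]] _; exists (br x y).
have [C CE] := center_subspace br.
have [P [sP PC PK]] := orthogonal_projection g C.
have Pc x : central br (P x) by apply/CE.
have Pid x : central br x -> P x = x by move/CE; apply: PK.
pose OBC := orthogonal_biinvariant_complex_structures br g.
pose related S J := OBC J /\ exists2 alpha, S alpha & associated g P J alpha.
have related_unique alpha J J' :
    related (pos_ray alpha) J -> related (pos_ray alpha) J' -> J = J'.
  move=> [oJ [beta [c c0 cE] aJ]] [oJ' [beta' [c' c'0 c'E] aJ']].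
  have c_neq0 : c != 0 by rewrite gt_eqF.
  apply: (associated_inj Pc Pid oJ oJ' n0 (c := c' / c) _ _ aJ aJ').
    by rewrite divr_gt0.
  by move=> x y; rewrite c'E cE; field.
have self alpha : pos_ray alpha alpha.
  by exists 1 => // x y; rewrite mul1r.
(* A ray is sent to the complex structure associated with any of its members. *)
pose F S := xget 0 [set J | related S J].
have FE alpha J : related (pos_ray alpha) J -> F (pos_ray alpha) = J.
  by move=> r; apply: xget_unique => // J' /related_unique; apply.
have FP S : killing_rays br nabla S -> related S (F S).
  move=> [alpha [K nz] <-]; have [J oJ aJ] :=
    associated_killing hLie sP Pc Pid hnil hirr hnabla K nz.
  rewrite (FE _ J) //; by split=> //; exists alpha.
exists F; split.
- by move=> S /FP[].
- move=> S S' /set_mem SK /set_mem SK' FSS'.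
  have [_ [beta Sbeta [c c0 cE]]] := FP _ SK.
  have [_ [beta' Sbeta' [c' c'0 c'E]]] := FP _ SK'.
  case: SK Sbeta => alpha _ <- [d d0 dE]; case: SK' Sbeta' => alpha' _ <- [d' d'0 d'E].
  rewrite (pos_ray_eq d0 dE) (pos_ray_eq d'0 d'E).
  apply: (@pos_ray_eq _ _ _ _ (c' / c)); first by rewrite divr_gt0.
  have c_neq0 : c != 0 by rewrite gt_eqF.
  by move=> x y; rewrite c'E cE FSS'; field.
move=> J oJ.
have [alpha [aJ K nz]] := associated_exists hLie sP Pc Pid hnil hnabla oJ.
exists (pos_ray alpha); first by exists alpha.
by apply: FE; split=> //; exists alpha.
Qed.
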